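(* The measures $\Gamma_{\mathcal{S}}-1$, $\Gamma^\cup_{\mathcal{S}_+}-1$, $R^{\mathcal{S}_+}_{\mathcal{S}_+}$ and $R^{\mathbb{D}}_{\mathcal{S}_+}$ are all convex on $\mathbb{D}$: for each such $M$, $M\big(\sum_i t_i\rho_i\big)\le\sum_i t_i M(\rho_i)$ for all finite families $\rho_i\in\mathbb{D}$, $t_i\in\mathbb{R}_+$ with $\sum_i t_i=1$.
   Context: Fix $d\ge 1$. $\mathcal{V}\subseteq\mathbb{C}^d$ is a nonempty compact set of unit vectors such that $|\psi\rangle\in\mathcal{V}$ implies $e^{i\theta}|\psi\rangle\in\mathcal{V}$ for all real $\theta$. $\mathbb{D}$ is the set of $d\times d$ density matrices. Put $\mathcal{S}_+=\{|v\rangle\langle v| : |v\rangle\in\mathcal{V}\}$ and $\mathcal{S}=\{|v\rangle\langle w| : |v\rangle,|w\rangle\in\mathcal{V}\}\subseteq\mathbb{C}^{d\times d}$. For a compact set $\mathcal{A}$ in a finite-dimensional vector space, the atomic gauge is $\Gamma_{\mathcal{A}}(x)=\inf\{\lambda\in\mathbb{R}_+ : x\in\lambda\,\mathrm{conv}(\mathcal{A})\}=\inf\{\sum_i c_i : x=\sum_i c_i a_i \text{ (finite sum)},\ a_i\in\mathcal{A},\ c_i\in\mathbb{R}_+\}$, with $\inf\emptyset=\infty$ (so all functions may take the value $\infty$; as usual $0\cdot\infty=0$ in the convexity inequality). The convex roof extension is $$\Gamma^\cup_{\mathcal{S}_+}(\rho)=\inf\Big\{\sum_i p_i\,\Gamma_{\mathcal{V}}(|\psi_i\rangle)^2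 : \rho=\sum_i p_i|\psi_i\rangle\langle\psi_i|,\ \sum_i p_i=1,\ p_i\in\mathbb{R}_+\Big\}$$ over finite decompositions with $|\psi_i\rangle$ unit vectors. Let $\mathcal{S}_+^{**}=\mathbb{R}_+\mathrm{conv}(\mathcal{S}_+)$. For $\mathcal{X}\subseteq\mathbb{D}$ closed, $R^{\mathcal{X}}_{\mathcal{S}_+}(\rho)=\inf\{s\in\mathbb{R}_+ : \exists\,\omega\in\mathrm{conv}(\mathcal{X}),\ \rho+s\omega\in\mathcal{S}_+^{**}\}$; $\mathcal{X}=\mathcal{S}_+$ gives the standard robustness and $\mathcal{X}=\mathbb{D}$ the generalised robustness. *)

(* Defs.v *)
(* The complex numbers are R[i] for a realType R. *)
From HB Require Import structures.
From mathcomp Require Import all_boot all_order all_algebra.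
From mathcomp Require Import complex.
From mathcomp Require Import all_classical all_reals all_analysis.

Set Implicit Arguments.
Unset Strict Implicit.
Unset Printing Implicit Defensive.

Import Order.TTheory GRing.Theory Num.Theory.
Import numFieldNormedType.Exports.

Local Open Scope classical_set_scope.
Local Open Scope ring_scope.
Local Open Scope complex_scope.
Local Open Scope sesquilinear_scope.

(* Kets are column vectors; <v| is the conjugate transpose v ^t*. *)
Definition ketbra {R : realType} {d : nat} (v w : 'cV[R[i]]_d) : 'M[R[i]]_d :=
  v *m w ^t*.

(* Euclidean norm; the norm that the library puts on matrices is the sup norm. *)
Definition unit_vector {R : realType} {d : nat} (v : 'cV[R[i]]_d) : Prop :=
  (v ^t* *m v) 0 0 = 1.

(* [0 <= z] in R[i] says that z is real and nonnegative. *)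
Definition density {R : realType} {d : nat} : set 'M[R[i]]_d :=
  [set rho | [/\ rho \is hermsymmx,
                 forall v : 'cV[R[i]]_d, 0 <= (v ^t* *m rho *m v) 0 0
               & \tr rho = 1]].

Section atomic.
Context {R : realType} {E : lmodType R[i]}.

Definition conv (A : set E) : set E :=
  [set x | exists (n : nat) (c : 'I_n -> R) (a : 'I_n -> E),
     [/\ forall i, 0 <= c i, \sum_i c i = 1, forall i, A (a i)
       & x = \sum_i (c i)%:C *: a i]].

Definition gauge (A : set E) (x : E) : \bar R :=
  ereal_inf [set l%:E | l in
    [set l : R | 0 <= l /\ exists2 y, conv A y & x = l%:C *: y]].

Definition cone (A : set E) : set E :=
  [set x | exists2 l : R, 0 <= l & exists2 y, conv A y & x = l%:C *: y].

End atomic.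

Section measures.
Context {R : realType} {d : nat}.
Implicit Type V : set 'cV[R[i]]_d.

Definition atoms V : set 'M[R[i]]_d :=
  [set ketbra v w | v in V & w in V].

Definition pos_atoms V : set 'M[R[i]]_d :=
  [set ketbra v v | v in V].

Definition convex_roof V (rho : 'M[R[i]]_d) : \bar R :=
  ereal_inf [set z : \bar R |
    exists (n : nat) (p : 'I_n -> R) (psi : 'I_n -> 'cV[R[i]]_d),
      [/\ forall i, 0 <= p i, \sum_i p i = 1, forall i, unit_vector (psi i),
          rho = \sum_i (p i)%:C *: ketbra (psi i) (psi i)
        & z = (\sum_i (p i)%:E * gauge V (psi i) ^+ 2)%E]].

Definition robustness V (X : set 'M[R[i]]_d) (rho : 'M[R[i]]_d) : \bar R :=
  ereal_inf [set s%:E | s in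
    [set s : R | 0 <= s /\
       exists2 omega, conv X omega &
         cone (pos_atoms V) (rho + s%:C *: omega)]].

(* In \bar R, 0 * +oo = 0. *)
Definition convex_on_density (M : 'M[R[i]]_d -> \bar R) : Prop :=
  forall (n : nat) (t : 'I_n -> R) (rho : 'I_n -> 'M[R[i]]_d),
    (forall i, 0 <= t i) -> \sum_i t i = 1 -> (forall i, density (rho i)) ->
    (M (\sum_i (t i)%:C *: rho i)%R <= \sum_i (t i)%:E * M (rho i))%E.

End measures.

(* Main.v *)
(* Each measure is the infimum of a nonnegative family of costs of
   decompositions of rho, and decompositions can be mixed: the t-average of
   decompositions of the rho_i is a decomposition of the t-average of the
   rho_i, at the averaged cost.  Taking eps-optimal decompositions gives
   convexity. *)
Require Import Defs.
From mathcomp Require Import all_boot all_order all_algebra.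
From mathcomp Require Import complex.
From mathcomp Require Import all_classical all_reals all_analysis.

Set Implicit Arguments.
Unset Strict Implicit.
Unset Printing Implicit Defensive.

Import Order.TTheory GRing.Theory Num.Theory.
Import numFieldNormedType.Exports.

Local Open Scope classical_set_scope.
Local Open Scope ring_scope.
Local Open Scope complex_scope.

(* [conv] alone now denotes the binary operation of MathComp-Analysis. *)
Local Notation conv := Defs.conv.

Lemma realC_mul (R : realType) (a b : R) : (a * b)%:C = a%:C * b%:C :> R[i].
Proof. exact: (rmorphM (real_complex R)). Qed.

(** * Convex and conic combinations, and infima of mixable costs *)

Section mixing.
Context {R : realType} {E : lmodType R[i]}.
Implicit Types (A : set E) (x y : E).

(** Enumerating [J] turns the sum into one over ordinals, as [conv] demands. This allows index types
    such as dependent pairs. *)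
Lemma conv_finsum A (J : finType) (c : J -> R) (a : J -> E) :
  (forall j, 0 <= c j) -> \sum_j c j = 1 -> (forall j, A (a j)) ->
  conv A (\sum_j (c j)%:C *: a j).
Proof.
move=> c0 c1 Aa; exists #|J|, (c \o enum_val), (a \o enum_val); split=> //=.
- by rewrite -c1 [RHS](big_enum_val c).
- by rewrite [LHS](big_enum_val (fun j => (c j)%:C *: a j)).
Qed.

(** A nested combination flattens: index by pairs (i, j) and multiply the outer weight by the inner
    one. *)
Lemma conv_idem A x : conv (conv A) x -> conv A x.
Proof.
move=> [n [c [y [c0 c1 Ay ->]]]].
(* The number of terms varies with [i], so length, weights and points are packed together and chosen
   at once. *)
have /choice[f fP] : forall i : 'I_n,
    exists p : {m : nat & (('I_m -> R) * ('I_m -> E))%type},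
    [/\ forall j, 0 <= (projT2 p).1 j, \sum_j (projT2 p).1 j = 1,
        forall j, A ((projT2 p).2 j)
      & y i = \sum_j ((projT2 p).1 j)%:C *: (projT2 p).2 j].
  by move=> i; have [m [b [a H]]] := Ay i; exists (existT _ m (b, a)).
pose w (p : {i : 'I_n & 'I_(projT1 (f i))}) : R :=
  c (tag p) * (projT2 (f (tag p))).1 (tagged p).
pose a (p : {i : 'I_n & 'I_(projT1 (f i))}) : E :=
  (projT2 (f (tag p))).2 (tagged p).
rewrite (_ : \sum_i _ = \sum_p (w p)%:C *: a p).
  apply: conv_finsum => [p||p].
  - by have [h _ _ _] := fP (tag p); rewrite mulr_ge0.
  - rewrite -(sig_big_dep xpredT (fun=> xpredT)
      (fun i j => c i * (projT2 (f i)).1 j)) -[RHS]c1.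
    by apply: eq_bigr => i _; have [_ h _ _] := fP i; rewrite -mulr_sumr h mulr1.
  - by have [_ _ h _] := fP (tag p); apply: h.
rewrite -(sig_big_dep xpredT (fun=> xpredT)
  (fun i j => (c i * (projT2 (f i)).1 j)%:C *: (projT2 (f i)).2 j)).
apply: eq_bigr => i _; have [_ _ _ ->] := fP i.
by rewrite scaler_sumr; apply: eq_bigr => j _; rewrite scalerA realC_mul.
Qed.

(** Dividing the weights by their total gives a convex combination. If the total is 0, both sides
    vanish and any point of [conv A] serves; indexing by [n.+1] provides one. *)
Lemma conv_conic_sum A n (c : 'I_n.+1 -> R) (y : 'I_n.+1 -> E) :
  (forall i, 0 <= c i) -> (forall i, conv A (y i)) ->
  exists2 z, conv A z & \sum_i (c i)%:C *: y i = (\sum_i c i)%:C *: z.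
Proof.
move=> c0 Ay; have [s0|s0] := eqVneq (\sum_i c i) 0.
  exists (y ord0) => //; rewrite s0 scale0r big1// => i _.
  have /eqP := s0; rewrite psumr_eq0// => /allP/(_ i (mem_index_enum _))/eqP ->.
  by rewrite scale0r.
exists (\sum_i (c i / \sum_j c j)%:C *: y i).
  apply/conv_idem/conv_finsum => //.
  - by move=> i; rewrite divr_ge0// sumr_ge0.
  - by rewrite -mulr_suml divff.
rewrite scaler_sumr; apply: eq_bigr => i _.
by rewrite scalerA -realC_mul mulrCA divff// mulr1.
Qed.

Lemma cone_conic_sum A n (c : 'I_n.+1 -> R) (x : 'I_n.+1 -> E) :
  (forall i, 0 <= c i) -> (forall i, cone A (x i)) ->
  cone A (\sum_i (c i)%:C *: x i).
Proof.
move=> c0 Ax; have [l l0 xy] := all_sig2 (fun i => cid2 (Ax i)).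
have [y Ay xE] := all_sig2 (fun i => cid2 (xy i)).
have [z Az zE] := conv_conic_sum (fun i => mulr_ge0 (c0 i) (l0 i)) Ay.
exists (\sum_i c i * l i); first by rewrite sumr_ge0// => i _; rewrite mulr_ge0.
exists z => //; rewrite -zE; apply: eq_bigr => i _.
by rewrite xE scalerA realC_mul.
Qed.

(* A value [+oo] of weight [0] is absorbed by moving that weight to a point of
   positive weight, since such a point need not have any finite cost. *)
Lemma ereal_inf_convex (F : E -> set \bar R) n (t : 'I_n -> R) (x : 'I_n -> E) :
  (forall y z, F y z -> (0 <= z)%E) ->
  (forall (y : 'I_n -> E) (z : 'I_n -> \bar R), (forall i, F (y i) (z i)) ->
     F (\sum_i (t i)%:C *: y i) (\sum_i (t i)%:E * z i)%E) ->
  (forall i, 0 <= t i) -> \sum_i t i = 1 ->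
  (ereal_inf (F (\sum_i (t i)%:C *: x i)%R)
     <= \sum_i (t i)%:E * ereal_inf (F (x i)))%E.
Proof.
move=> F0 Fmix t0 t1.
have inf0 y : (0 <= ereal_inf (F y))%E.
  by apply: le_ereal_inf_tmp => z; apply: F0.
have [/existsP[i /andP[ti /eqP Fi]]|/existsPn Ffin] :=
    boolP [exists i, (t i != 0) && (ereal_inf (F (x i)) == +oo%E)].
  (* An infinite infimum of positive weight makes the right side [+oo], since the other terms are
     nonnegative. *)
  rewrite [leRHS](bigD1 i)//= Fi gt0_muley ?lte_fin ?lt0r ?ti ?t0//.
  rewrite addye ?leey// gt_eqF// (lt_le_trans ltNy0)// sume_ge0// => j _.
  by rewrite mule_ge0// lee_fin.
have /existsP[i0 ti0] : [exists i, t i != 0].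
  apply: contraT => /existsPn h; move: t1; rewrite big1 => [/eqP|j _].
    by rewrite eq_sym oner_eq0.
  by apply/eqP; have := h j; rewrite negbK.
pose x' i := if t i == 0 then x i0 else x i.
have x'fin i : ereal_inf (F (x' i)) \is a fin_num.
  rewrite ge0_fin_numE// ltey /x'; case: (eqVneq (t i) 0) => ti.
    by have := Ffin i0; rewrite ti0.
  by have := Ffin i; rewrite ti.
rewrite (_ : \sum_i _ = \sum_i (t i)%:C *: x' i)%R; last first.
  by apply: eq_bigr => i _; rewrite /x'; case: eqP => [->|//]; rewrite !scale0r.
rewrite (_ : \sum_i _ = \sum_i (t i)%:E * ereal_inf (F (x' i)))%E; last first.
  by apply: eq_bigr => i _; rewrite /x'; case: eqP => [->|//]; rewrite !mul0e.
apply/lee_addgt0Pr => e e0.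
have [z Fz zlt] :=
  all_sig2 (fun i => cid2 (lb_ereal_inf_adherent e0 (x'fin i))).
apply: le_trans (ereal_inf_lbound (Fmix _ _ Fz)) _.
(* The weights sum to 1, so an error [e] at each point averages to exactly [e]. *)
apply: (@le_trans _ _ (\sum_i (t i)%:E * (ereal_inf (F (x' i)) + e%:E))%E).
  by apply: lee_sum => i _; rewrite lee_wpmul2l ?lee_fin// ltW.
under eq_bigr do rewrite muleDr ?fin_num_adde_defr//.
rewrite big_split/= leeD2l// -ge0_sume_distrl ?sumEFin ?t1 ?mul1e// => i _.
by rewrite lee_fin.
Qed.

End mixing.

(** * Convexity of each measure *)

Section measures.
Context {R : realType} {d : nat}.
Implicit Types (V : set 'cV[R[i]]_d) (A X : set 'M[R[i]]_d).

(** The weights sum to 1, so averaging takes out the constant exactly; as 1 is finite, this also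
    works at infinite values of [M]. *)
Lemma convex_on_densityB1 (M : 'M[R[i]]_d -> \bar R) :
  (forall rho, (0 <= M rho)%E) -> convex_on_density M ->
  convex_on_density (fun rho => M rho - 1)%E.
Proof.
move=> M0 Mconv n t rho t0 t1 rhoD.
under [leRHS]eq_bigr do rewrite muleDr ?fin_num_adde_defl//.
rewrite big_split/= -ge0_sume_distrl ?sumEFin ?t1 ?mul1e; last first.
  by move=> i _; rewrite lee_fin.
by rewrite leeD2r// Mconv.
Qed.

Lemma gauge_convex A : convex_on_density (gauge A).
Proof.
(* Weights with sum 1 exclude the empty family, which gives the [n.+1] that [conv_conic_sum]
   expects. *)
case=> [|n] t rho t0 t1 _.
  by move: t1; rewrite big_ord0 => /esym/eqP; rewrite oner_eq0.
apply: (ereal_inf_convex (F := fun x => [set l%:E | l in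
  [set l : R | 0 <= l /\ exists2 y, conv A y & x = l%:C *: y]])) => //.
  by move=> y _ [l [l0 _] <-]; rewrite lee_fin.
move=> y z Fyz.
have [l /all_and2[l0 yE] zE] := all_sig2 (fun i => cid2 (Fyz i)).
have [u Au uE] := all_sig2 (fun i => cid2 (yE i)).
have [v Av vE] := conv_conic_sum (fun i => mulr_ge0 (t0 i) (l0 i)) Au.
exists (\sum_i t i * l i); last first.
  by rewrite -sumEFin; apply: eq_bigr => i _; rewrite -zE.
split; first by rewrite sumr_ge0// => i _; rewrite mulr_ge0.
exists v => //; rewrite -vE; apply: eq_bigr => i _.
by rewrite uE scalerA realC_mul.
Qed.

(** The noise terms [s i *: u i] average to a single noise term of strength [\sum_i t i * s i], and
    the cone is closed under conic sums. Leaving [X] general covers both robustnesses. *)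
Lemma robustness_convex V X : convex_on_density (robustness V X).
Proof.
case=> [|n] t rho t0 t1 _.
  by move: t1; rewrite big_ord0 => /esym/eqP; rewrite oner_eq0.
apply: (ereal_inf_convex (F := fun x => [set s%:E | s in [set s : R | 0 <= s /\
  exists2 omega, conv X omega & cone (pos_atoms V) (x + s%:C *: omega)]])) => //.
  by move=> y _ [l [l0 _] <-]; rewrite lee_fin.
move=> y z Fyz.
have [s /all_and2[s0 yE] zE] := all_sig2 (fun i => cid2 (Fyz i)).
have [u Xu yC] := all_sig2 (fun i => cid2 (yE i)).
have [v Xv vE] := conv_conic_sum (fun i => mulr_ge0 (t0 i) (s0 i)) Xu.
exists (\sum_i t i * s i); last first.
  by rewrite -sumEFin; apply: eq_bigr => i _; rewrite -zE.
split; first by rewrite sumr_ge0// => i _; rewrite mulr_ge0.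
exists v => //; rewrite -vE -big_split/=.
under eq_bigr do rewrite realC_mul -scalerA -scalerDr.
exact: cone_conic_sum.
Qed.

(** The set whose infimum is [convex_roof], named to serve as the cost family [F] of
    [ereal_inf_convex]. *)
Definition roof_costs V (rho : 'M[R[i]]_d) : set \bar R :=
  [set z : \bar R |
    exists (n : nat) (p : 'I_n -> R) (psi : 'I_n -> 'cV[R[i]]_d),
      [/\ forall i, 0 <= p i, \sum_i p i = 1, forall i, unit_vector (psi i),
          rho = \sum_i (p i)%:C *: ketbra (psi i) (psi i)
        & z = (\sum_i (p i)%:E * gauge V (psi i) ^+ 2)%E]].

Lemma roof_costs_ge0 V rho z : roof_costs V rho z -> (0 <= z)%E.
Proof.
move=> [n [p [psi [p0 _ _ _ ->]]]]; apply: sume_ge0 => i _.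
by rewrite mule_ge0 ?lee_fin ?sqre_ge0.
Qed.

Lemma roof_costs_finsum V (J : finType) (p : J -> R) (psi : J -> 'cV[R[i]]_d) :
  (forall j, 0 <= p j) -> \sum_j p j = 1 -> (forall j, unit_vector (psi j)) ->
  roof_costs V (\sum_j (p j)%:C *: ketbra (psi j) (psi j))
    (\sum_j (p j)%:E * gauge V (psi j) ^+ 2)%E.
Proof.
move=> p0 p1 psi1.
exists #|J|, (p \o enum_val), (psi \o enum_val); split=> //=.
- by rewrite -p1 [RHS](big_enum_val p).
- by rewrite [LHS](big_enum_val (fun j => (p j)%:C *: ketbra (psi j) (psi j))).
- by rewrite [LHS](big_enum_val (fun j => (p j)%:E * gauge V (psi j) ^+ 2)%E).
Qed.

(** Flattening as in [conv_idem], with the cost carried along: the pair (i, j) receives the weight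
    [t i] times the inner weight. *)
Lemma roof_costs_mix V n (t : 'I_n -> R) (y : 'I_n -> 'M[R[i]]_d)
    (z : 'I_n -> \bar R) :
  (forall i, 0 <= t i) -> \sum_i t i = 1 ->
  (forall i, roof_costs V (y i) (z i)) ->
  roof_costs V (\sum_i (t i)%:C *: y i) (\sum_i (t i)%:E * z i)%E.
Proof.
move=> t0 t1 yz.
have /choice[f fP] : forall i : 'I_n,
    exists q : {m : nat & (('I_m -> R) * ('I_m -> 'cV[R[i]]_d))%type},
    [/\ forall j, 0 <= (projT2 q).1 j, \sum_j (projT2 q).1 j = 1,
        forall j, unit_vector ((projT2 q).2 j),
        y i = \sum_j ((projT2 q).1 j)%:C
                *: ketbra ((projT2 q).2 j) ((projT2 q).2 j)
      & z i = (\sum_j ((projT2 q).1 j)%:E * gauge V ((projT2 q).2 j) ^+ 2)%E].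
  by move=> i; have [m [b [a H]]] := yz i; exists (existT _ m (b, a)).
pose w (p : {i : 'I_n & 'I_(projT1 (f i))}) : R :=
  t (tag p) * (projT2 (f (tag p))).1 (tagged p).
pose a (p : {i : 'I_n & 'I_(projT1 (f i))}) : 'cV[R[i]]_d :=
  (projT2 (f (tag p))).2 (tagged p).
rewrite (_ : \sum_i (t i)%:C *: _ = \sum_p (w p)%:C *: ketbra (a p) (a p)).
  rewrite (_ : \sum_i _ = \sum_p (w p)%:E * gauge V (a p) ^+ 2)%E.
    apply: roof_costs_finsum => [p||p].
    - by have [h _ _ _ _] := fP (tag p); rewrite mulr_ge0.
    - rewrite -(sig_big_dep xpredT (fun=> xpredT)
        (fun i j => t i * (projT2 (f i)).1 j)) -[RHS]t1.
      by apply: eq_bigr => i _; have [_ h _ _ _] := fP i;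
        rewrite -mulr_sumr h mulr1.
    - by have [_ _ h _ _] := fP (tag p); apply: h.
  rewrite -(sig_big_dep xpredT (fun=> xpredT) (fun i j =>
    (t i * (projT2 (f i)).1 j)%:E * gauge V ((projT2 (f i)).2 j) ^+ 2)%E).
  apply: eq_bigr => i _; have [p0 _ _ _ ->] := fP i.
  (* Gauges may be infinite, so distributing [t i] over the sum relies on the terms being
     nonnegative. *)
  rewrite ge0_sume_distrr => [|j _]; last by rewrite mule_ge0 ?lee_fin ?sqre_ge0.
  by apply: eq_bigr => j _; rewrite EFinM muleA.
rewrite -(sig_big_dep xpredT (fun=> xpredT) (fun i j =>
  (t i * (projT2 (f i)).1 j)%:C
    *: ketbra ((projT2 (f i)).2 j) ((projT2 (f i)).2 j))).
apply: eq_bigr => i _; have [_ _ _ -> _] := fP i.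
by rewrite scaler_sumr; apply: eq_bigr => j _; rewrite scalerA realC_mul.
Qed.

Lemma convex_roof_convex V : convex_on_density (convex_roof V).
Proof.
move=> n t rho t0 t1 _; apply: (ereal_inf_convex (F := roof_costs V)) => //.
  exact: roof_costs_ge0.
by move=> y z; apply: roof_costs_mix.
Qed.

End measures.

(* R[i]^o is R[i] as a normed module over itself, which carries the topology. *)
Theorem proposition15 (R : realType) (d : nat) (V : set 'cV[R[i]]_d)
    (d_ge1 : (1 <= d)%N)
    (V_neq0 : V !=set0)
    (V_compact : compact (V : set 'cV[R[i]^o]_d))
    (V_unit : forall v, V v -> unit_vector v)
    (V_phase : forall v, V v ->
       forall theta : R, V ((cos theta +i* sin theta) *: v)) :
  [/\ convex_on_density (fun rho => gauge (atoms V) rho - 1)%E,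
      convex_on_density (fun rho => convex_roof V rho - 1)%E,
      convex_on_density (robustness V (pos_atoms V))
    & convex_on_density (robustness V density)].
Proof.
split.
- apply: convex_on_densityB1; last exact: gauge_convex.
  by move=> rho; apply: le_ereal_inf_tmp => _ [l [l0 _] <-]; rewrite lee_fin.
- apply: convex_on_densityB1; last exact: convex_roof_convex.
  by move=> rho; apply: le_ereal_inf_tmp => z; apply: roof_costs_ge0.
- exact: robustness_convex.
- exact: robustness_convex.
Qed.
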